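(* Let $\mathcal{M}_{NC}$ and $\mathcal{M}_{NA}$ denote the sets of negatively correlated and of negatively associated probability measures on the Boolean cube $I_n=\{0,1\}^n$, regarded as subsets of the space of all probability measures on $I_n$. Then $$\partial\mathcal{M}_{NC}\subset\{\mu\in\mathcal{M}_{NC}:\mu^{(i,j)}(1,1)=\mu^{(i)}(1)\mu^{(j)}(1)\text{ for some } i\ne j\}$$ and $$\partial\mathcal{M}_{NA}\subset\{\mu\in\mathcal{M}_{NA}:\text{there exist non-constant, non-decreasing } f,g \text{ with } \mathrm{Cov}_\mu(f(x_I),g(x_J))=0\},$$ where $I$ and $J$ are disjoint subsets of $\{1,\dots,n\}$. Moreover, the interior of $\mathcal{M}_{NC}$ and the interior of $\mathcal{M}_{NA}$ are non-empty.
   Context: A probability measure $\mu$ on $I_n=\{0,1\}^n$ is identified with a vector of $2^n$ non-negative numbers summing to 1; the space of such measures has the Euclidean topology (equal to both the weak and total variation topologies), and boundary $\partial$ and interior are taken in this space. $\mu^{(i)}$ and $\mu^{(i,j)}$ denote the one- and two-dimensional marginals, so $\mu^{(i)}(1)=\mu(x_i=1)$ and $\mu^{(i,j)}(1,1)=\mu(x_i=x_j=1)$. $\mu$ is negatively correlated (NC) if $\mu^{(i,j)}(1,1)\le\mu^{(i)}(1)\mu^{(j)}(1)$ for all $i\neq j$. A function of several $\{0,1\}$-valued coordinates is non-decreasing if it is so with respect to the coordinatewise order; $x_I$ is the restriction of $x$ to coordinates in $I\subset\{1,\dots,n\}$. $\mu$ is negatively associated (NA) if $\mathrm{Cov}_\mu(f(x_I),g(x_J))=\int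 f(x_I)g(x_J)\,d\mu-\int f(x_I)\,d\mu\int g(x_J)\,d\mu\le0$ for all disjoint $I,J\subset\{1,\dots,n\}$ and all non-decreasing $f:\{0,1\}^{I}\to\mathbb{R}$, $g:\{0,1\}^{J}\to\mathbb{R}$. In the second inclusion, the disjoint sets $I,J$ are existentially quantified together with $f,g$. *)

(* Defs.v *)
From mathcomp Require Import all_boot all_order all_algebra.
From mathcomp Require Import all_classical all_reals all_analysis.
Import Order.TTheory GRing.Theory Num.Theory.
Import numFieldNormedType.Exports.

Set Implicit Arguments.
Unset Strict Implicit.
Unset Printing Implicit Defensive.

Local Open Scope classical_set_scope.
Local Open Scope ring_scope.

Notation subcube I := {ffun {i | i \in I} -> bool}.

Definition cube (n : nat) := {ffun 'I_n -> bool}.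

Definition restr (n : nat) (I : {set 'I_n}) (x : cube n) : subcube I :=
  [ffun i => x (val i)].

(* The topology on the vectors indexed by the cube is the product topology of
   R^(2^n), and [cube_prob R n], seen as a type, carries the induced topology;
   hence closures and interiors of sets of measures are relative to the simplex. *)
Definition cube_prob (R : realType) (n : nat) : set {ptws cube n -> R} :=
  [set m | (forall x, 0 <= m x) /\ \sum_(x : cube n) m x = 1].
Arguments cube_prob : clear implicits.

Definition mass (R : realType) (n : nat) (mu : cube_prob R n) (x : cube n) : R :=
  (set_val mu : cube n -> R) x.

Definition marginal1 (R : realType) (n : nat) (mu : cube_prob R n) (i : 'I_n)
    (a : bool) : R :=
  \sum_(x : cube n | x i == a) mass mu x.

Definition marginal2 (R : realType) (n : nat) (mu : cube_prob R n) (i j : 'I_n)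
    (a b : bool) : R :=
  \sum_(x : cube n | (x i == a) && (x j == b)) mass mu x.

Definition mean (R : realType) (n : nat) (mu : cube_prob R n)
    (h : cube n -> R) : R :=
  \sum_(x : cube n) h x * mass mu x.

Definition cube_cov (R : realType) (n : nat) (mu : cube_prob R n)
    (f g : cube n -> R) : R :=
  mean mu (fun x => f x * g x) - mean mu f * mean mu g.

Definition nondecr (R : realType) (n : nat) (I : {set 'I_n})
    (f : subcube I -> R) : Prop :=
  forall x y : subcube I, (forall i, (x i <= y i)%O) -> f x <= f y.

Definition nonconst (R : realType) (n : nat) (I : {set 'I_n})
    (f : subcube I -> R) : Prop :=
  exists x y : subcube I, f x <> f y.

Definition NC (R : realType) (n : nat) : set (cube_prob R n) :=
  [set mu | forall i j : 'I_n, i != j ->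
     marginal2 mu i j true true <= marginal1 mu i true * marginal1 mu j true].
Arguments NC : clear implicits.

Definition NA (R : realType) (n : nat) : set (cube_prob R n) :=
  [set mu | forall (I J : {set 'I_n}), [disjoint I & J]%B ->
     forall (f : subcube I -> R) (g : subcube J -> R),
     nondecr f -> nondecr g ->
     cube_cov mu (f \o @restr n I) (g \o @restr n J) <= 0].
Arguments NA : clear implicits.

Definition boundary (T : topologicalType) (A : set T) : set T :=
  closure A `\` A°.

(* Main.v *)
Require Import Defs.
From mathcomp Require Import all_boot all_order all_algebra.
From mathcomp Require Import all_classical all_reals all_analysis.
From mathcomp Require Import ring.
Import Order.TTheory GRing.Theory Num.Theory.
Import numFieldNormedType.Exports.

Local Open Scope classical_set_scope.
Local Open Scope ring_scope.

(** Negative correlation is a finite system of inequalities c <= 0, where c is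
    the covariance of two coordinates and hence continuous in the measure.
    For any such system, a point where every inequality is strict is interior
    to the solution set; so a boundary point solves the system, by closedness,
    with equality somewhere ([boundary_constraints]).

    Negative association quantifies over infinitely many pairs of functions,
    but a non-decreasing function on a cube is a constant plus a non-negative
    combination of indicators of non-trivial up-sets ([nondecr_ind]).  As
    covariance is bilinear and kills constants, only the finitely many pairs
    of such indicators matter ([NA_constraints]), and the same argument yields
    the second inclusion, with indicators as the functions f and g.

    For the interiors it suffices, since NA is contained in NC, to find one
    measure for which all these covariances are negative.  Give x the weight
    e ^ (k ^ 2), with k the number of ones of x and e small.  If a and b are
    the least numbers of ones needed for two events E and F that depend on
    disjoint sets of coordinates, then E has weight at least e ^ (a ^ 2), F at
    least e ^ (b ^ 2), and their intersection, which needs a + b ones, only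
    O(e ^ ((a + b) ^ 2)).  For non-trivial up-sets a and b are positive, so the
    cross term 2ab in the exponent makes the covariance negative once e is
    small compared with the number of points ([total_weight_setI_lt]). *)

(** * Boundary and interior of a finite system of inequalities *)

Section FiniteConstraints.
Variables (R : realType) (T : topologicalType) (K : finType) (P : set K).
Variable c : K -> T -> R.
Hypothesis c_continuous : forall k, continuous (c k).

Lemma interior_strict (t : T) :
  (forall k, P k -> c k t < 0) -> [set s | forall k, P k -> c k s <= 0]° t.
Proof.
move=> ct; rewrite /interior.
apply: filter_forall => k.
have [Pk|nPk] := pselect (P k); last by apply: nearW.
near=> s => _; apply: ltW; near: s.
exact: cvgr_lt (c_continuous k t) _ (ct k Pk).
Unshelve. all: by end_near.
Qed.

Lemma boundary_constraints :
  boundary [set s | forall k, P k -> c k s <= 0] `<=`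
  [set s | (forall k, P k -> c k s <= 0) /\ exists k, P k /\ c k s = 0].
Proof.
move=> t [cl_t nint_t].
have ct k : P k -> c k t <= 0.
  move=> Pk; have cl : closed [set s | c k s <= 0].
    by apply: (@preimage_closed _ _ (c k) [set x | x <= 0]) => [s _|];
      [exact: c_continuous|exact: closed_le].
  by apply: cl; apply: closureS cl_t => s; exact.
split=> //; have [//|no_tie] := pselect (exists k, P k /\ c k t = 0).
case: nint_t; apply: interior_strict => k Pk.
rewrite lt_neqAle ct// andbT; apply/eqP => ck0.
by apply: no_tie; exists k.
Qed.

End FiniteConstraints.

(** * Non-decreasing functions as combinations of up-sets *)

Definition indic_of {R : realType} {T : finType} (A : {set T}) : T -> R :=
  fun x => (x \in A)%:R.

Section NondecreasingFunctions.
Variables (R : realType) (n : nat) (I : {set 'I_n}).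
Implicit Types (f : subcube I -> R) (A : {set subcube I}).

(** Layer-cake decomposition as an induction principle.  Subtracting from f
    the right multiple of the indicator of the set where f exceeds its minimum,
    which is its value at the bottom point, lowers the second smallest value of
    f to the minimum, so that this set shrinks.  [nondecr] and [nonconst] for an
    indicator say that the set is an up-set, neither empty nor full. *)
Lemma nondecr_ind (Q : (subcube I -> R) -> Prop) :
  (forall c, Q (fun=> c)) ->
  (forall f A c, nondecr (indic_of A : _ -> R) ->
     nonconst (indic_of A : _ -> R) -> 0 <= c -> Q f ->
     Q (fun x => f x + c * indic_of A x)) ->
  forall f, nondecr f -> Q f.
Proof.
move=> Qc QA f.
pose bot : subcube I := [ffun=> false].
have [m] := ubnP #|[set x | f bot < f x]%SET|.
elim: m f => // m IH f cardf f_nd.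
have bot_le x : f bot <= f x by apply: f_nd => i; rewrite ffunE.
have [A0|[y yA]] := set_0Vmem [set x | f bot < f x]%SET.
  rewrite (_ : f = (fun=> f bot)); first exact: Qc.
  apply/funext => x; apply/eqP; rewrite eq_le bot_le andbT leNgt.
  by apply/negP => x_gt; have := finset.in_set0 x; rewrite -A0 inE x_gt.
(* f z is the second smallest value of f, and b the gap to be removed. *)
pose z := [arg min_(u < y in [set x | f bot < f x]%SET) f u]%O.
have [zA z_min] : f bot < f z /\ forall x, f bot < f x -> f z <= f x.
  rewrite /z; case: arg_minP => // u; rewrite inE => uA umin.
  by split=> // x xA; apply: umin; rewrite inE.
pose A := [set x | f bot < f x]%SET.
pose b := f z - f bot.
have b_gt0 : 0 < b by rewrite subr_gt0.
pose g x := f x - b * indic_of A x.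
have gbot : g bot = f bot by rewrite /g /indic_of inE ltxx mulr0 subr0.
have notA x : x \notin A -> f x = f bot.
  by rewrite inE -leNgt => x_le; apply/eqP; rewrite eq_le x_le bot_le.
have A_up (x x' : subcube I) :
    (forall i, (x i <= x' i)%O) -> x \in A -> x' \in A.
  by rewrite !inE => le_xx' xA; apply: lt_le_trans (f_nd _ _ le_xx').
rewrite (_ : f = fun x => g x + b * indic_of A x); last first.
  by apply/funext => x; rewrite subrK.
apply: QA (ltW b_gt0) _.
- move=> x x' le_xx'; rewrite /indic_of; have := A_up _ _ le_xx'.
  by case: (x \in A) => [->//|_]; rewrite ler0n.
- exists bot, z; rewrite /indic_of !inE ltxx zA.
  by move/eqP; rewrite eq_sym oner_eq0.
apply: IH.
  rewrite -ltnS; apply: leq_trans cardf; rewrite ltnS.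
  apply: proper_card; apply/properP; split.
    apply/fintype.subsetP => x; rewrite !inE gbot => /lt_le_trans; apply.
    by rewrite /g /indic_of lerBlDr lerDl mulr_ge0 ?ler0n// ltW.
  exists z; first by rewrite inE.
  by rewrite inE gbot /g /indic_of inE zA mulr1 /b subKr ltxx.
move=> x x' le_xx'; rewrite /g /indic_of.
have [xA|xA] := boolP (x \in A).
  by rewrite (A_up _ _ le_xx' xA) lerD2r f_nd.
rewrite mulr0 subr0 (notA _ xA).
have [x'A|x'A] := boolP (x' \in A); last by rewrite mulr0 subr0.
rewrite mulr1 lerBrDr /b addrC subrK; apply: z_min.
by rewrite inE in x'A.
Qed.

Lemma nontrivial_upset A :
  nondecr (indic_of A : _ -> R) -> nonconst (indic_of A : _ -> R) ->
  [ffun=> false] \notin A /\ exists y, y \in A.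
Proof.
move=> A_nd [x [y neq]]; split.
  apply/negP => bA.
  have inA u : u \in A.
    have := A_nd [ffun=> false] u; rewrite /indic_of bA.
    case: (u \in A) => // /(_ _) H; suff : (1 : R) <= 0 by rewrite ler10.
    by apply: H => i; rewrite ffunE.
  by apply: neq; rewrite /indic_of !inA.
have [xA|xA] := boolP (x \in A); first by exists x.
have [yA|yA] := boolP (y \in A); first by exists y.
by case: neq; rewrite /indic_of (negbTE xA) (negbTE yA).
Qed.

End NondecreasingFunctions.

(** * Covariance on the cube *)

Section Covariance.
Context {R : realType} {n : nat}.
Implicit Types (mu : cube_prob R n) (f g h : cube n -> R).

Lemma mass_sum1 mu : \sum_x mass mu x = 1.
Proof. by have [_] := set_valP mu. Qed.

Lemma cube_covC mu f g : cube_cov mu f g = cube_cov mu g f.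
Proof.
rewrite /cube_cov mulrC; congr (_ - _); apply: eq_bigr => x _.
by rewrite (mulrC (f x)).
Qed.

Lemma cube_cov_cstl mu c g : cube_cov mu (fun=> c) g = 0.
Proof.
rewrite /cube_cov /mean -mulr_sumr mass_sum1 mulr1 mulr_sumr -sumrB.
by rewrite big1// => x _; rewrite mulrA subrr.
Qed.

Lemma cube_covDZl mu f c h g :
  cube_cov mu (fun x => f x + c * h x) g =
  cube_cov mu f g + c * cube_cov mu h g.
Proof.
have meanDZ u v : mean mu (fun x => u x + c * v x) = mean mu u + c * mean mu v.
  rewrite /mean mulr_sumr -big_split; apply: eq_bigr => x _ /=; ring.
rewrite /cube_cov (_ : (fun x => _ * g x) =
  fun x => f x * g x + c * (h x * g x)); last by apply/funext => x; ring.
by rewrite !meanDZ; ring.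
Qed.

Lemma mass_continuous x : continuous (fun mu : cube_prob R n => mass mu x).
Proof.
move=> mu.
have val_cvg :
    {for mu, continuous (set_val : cube_prob R n -> {ptws cube n -> R})}.
  exact: initial_continuous.
have coord_cvg := @proj_continuous (cube n) (fun=> R) x (set_val mu).
exact: (cvg_comp _ _ val_cvg coord_cvg).
Qed.

Lemma mean_continuous h : continuous (fun mu : cube_prob R n => mean mu h).
Proof.
apply: continuous_big; first exact: add_continuous.
move=> x _ mu; apply: (@cvgM _ _ (nbhs mu)); first exact: cvg_cst.
exact: mass_continuous.
Qed.

Lemma cube_cov_continuous f g :
  continuous (fun mu : cube_prob R n => cube_cov mu f g).
Proof.
move=> mu; apply: (@cvgB _ _ _ (nbhs mu)); first exact: mean_continuous.
by apply: (@cvgM _ _ (nbhs mu)); exact: mean_continuous.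
Qed.

(** Bilinearity lets the layer-cake decomposition be applied to one argument of
    the covariance at a time. *)
Lemma cube_cov_le0_indic mu (I J : {set 'I_n}) :
  (forall (A : {set subcube I}) (B : {set subcube J}),
    nondecr (indic_of A : _ -> R) -> nonconst (indic_of A : _ -> R) ->
    nondecr (indic_of B : _ -> R) -> nonconst (indic_of B : _ -> R) ->
    cube_cov mu (indic_of A \o @restr n I) (indic_of B \o @restr n J) <= 0) ->
  forall (f : subcube I -> R) (g : subcube J -> R), nondecr f -> nondecr g ->
    cube_cov mu (f \o @restr n I) (g \o @restr n J) <= 0.
Proof.
move=> covAB f g f_nd; move: g.
apply: nondecr_ind => [c|g B c B_nd B_nc c_ge0 covg].
  by rewrite cube_covC cube_cov_cstl.
rewrite cube_covC cube_covDZl -!(cube_covC mu (f \o _)).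
rewrite -[0]addr0 lerD// mulr_ge0_le0//.
elim/(@nondecr_ind R n I): f_nd {covg} => [d|f' A d A_nd A_nc d_ge0 covf].
  by rewrite cube_cov_cstl.
by rewrite cube_covDZl -[0]addr0 lerD// mulr_ge0_le0// covAB.
Qed.

End Covariance.

(** * The two classes as finite systems *)

Section ConstraintForm.
Variables (R : realType) (n : nat).

Definition coordinate (i : 'I_n) (x : cube n) : R := (x i)%:R.

Lemma mean_coordinate (mu : cube_prob R n) i :
  mean mu (coordinate i) = marginal1 mu i true.
Proof.
rewrite /mean /marginal1 [RHS]big_mkcond; apply: eq_bigr => x _.
by rewrite /coordinate eqb_id; case: (x i); rewrite ?mul1r ?mul0r.
Qed.

Lemma cube_cov_coordinate (mu : cube_prob R n) i j :
  cube_cov mu (coordinate i) (coordinate j) =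
  marginal2 mu i j true true - marginal1 mu i true * marginal1 mu j true.
Proof.
rewrite /cube_cov !mean_coordinate; congr (_ - _).
rewrite /mean /marginal2 [RHS]big_mkcond; apply: eq_bigr => x _.
rewrite /coordinate !eqb_id.
by case: (x i); case: (x j); rewrite ?mul1r ?mul0r.
Qed.

Lemma NC_constraints :
  NC R n = [set mu | forall k : 'I_n * 'I_n, k.1 != k.2 ->
              cube_cov mu (coordinate k.1) (coordinate k.2) <= 0].
Proof.
apply/seteqP; split=> mu H => [[i j] /= ij|i j ij].
  by rewrite cube_cov_coordinate subr_le0 H.
by rewrite -subr_le0 -cube_cov_coordinate (H (i, j)).
Qed.

(** Pairing the set of coordinates with the event makes the index set of the
    system for negative association a finite type. *)
Definition cylinder := {I : {set 'I_n} & {set subcube I}}.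

Definition cyl_indic (E : cylinder) : subcube (tag E) -> R :=
  indic_of (tagged E).

Definition cyl_cov (EF : cylinder * cylinder) (mu : cube_prob R n) : R :=
  cube_cov mu (cyl_indic EF.1 \o @restr n (tag EF.1))
              (cyl_indic EF.2 \o @restr n (tag EF.2)).

Definition increasing_pair : set (cylinder * cylinder) :=
  [set EF : cylinder * cylinder | [/\ [disjoint tag EF.1 & tag EF.2]%B,
    nonconst (cyl_indic EF.1) /\ nondecr (cyl_indic EF.1) &
    nonconst (cyl_indic EF.2) /\ nondecr (cyl_indic EF.2)]].

Lemma NA_constraints :
  NA R n = [set mu | forall EF, increasing_pair EF -> cyl_cov EF mu <= 0].
Proof.
apply/seteqP; split=> mu H.
  by move=> EF [dis [_ E_nd] [_ F_nd]]; exact: H.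
move=> I J dis; apply: cube_cov_le0_indic => A B A_nd A_nc B_nd B_nc.
exact: (H (existT _ I A, existT _ J B)).
Qed.

(** A coordinate is a non-decreasing function on a one-coordinate subcube. *)
Lemma NA_sub_NC : NA R n `<=` NC R n.
Proof.
move=> mu muNA; rewrite NC_constraints => -[i j] /= ij.
pose dict (k : 'I_n) (y : subcube [set k]%SET) : R := (y (Sub k (set11 k)))%:R.
have dict_nd k : nondecr (dict k).
  move=> x y /(_ (Sub k (set11 k))); rewrite /dict.
  by case: (x _); case: (y _).
have dictE k : dict k \o @restr n [set k] = coordinate k.
  by apply/funext => x; rewrite /dict /= ffunE.
rewrite -!dictE; apply: muNA => //.
by rewrite disjoints1 inE.
Qed.

End ConstraintForm.

(** * A measure with strictly negative covariances *)

Section RepulsiveMeasure.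
Variables (R : realType) (n : nat).
Implicit Types (x : cube n) (I J : {set 'I_n}) (E F : {set cube n}).

Definition ones x : {set 'I_n} := [set i | x i]%SET.

Definition zero_off I x : cube n := [ffun i => (i \in I) && x i].

(** Small enough for the square of [repulsion] to beat the two sums over the
    cube in [total_weight_setI_lt]. *)
Definition repulsion : R := #|{: cube n}|.+1%:R^-1.

Definition repulsive_weight x : R := repulsion ^+ (#|ones x| ^ 2).

Definition total_weight E : R := \sum_(x in E) repulsive_weight x.

Lemma repulsion_gt0 : 0 < repulsion.
Proof. by rewrite invr_gt0 ltr0n. Qed.

Lemma repulsion_le1 : repulsion <= 1.
Proof. by rewrite invf_le1 ?ltr0n// ler1n. Qed.

Lemma repulsive_weight_gt0 x : 0 < repulsive_weight x.
Proof. by rewrite exprn_gt0 ?repulsion_gt0. Qed.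

Lemma ones_zero_off I x : ones (zero_off I x) = I :&: ones x.
Proof. by apply/setP => i; rewrite !inE ffunE. Qed.

Lemma total_weight_le E k :
  (forall x, x \in E -> k <= #|ones x|)%N ->
  total_weight E <= #|{: cube n}|%:R * repulsion ^+ (k ^ 2).
Proof.
move=> kE; apply: (@le_trans _ _ (\sum_(x in E) repulsion ^+ (k ^ 2))).
  apply: ler_sum => x /kE kx; rewrite /repulsive_weight.
  by rewrite ler_wiXn2l ?repulsion_le1 ?ltW ?repulsion_gt0// leq_sqr.
rewrite sumr_const -[leLHS]mulr_natl ler_pM2r ?exprn_gt0 ?repulsion_gt0//.
by rewrite ler_nat max_card.
Qed.

Lemma total_weight_ge E x : x \in E -> repulsive_weight x <= total_weight E.
Proof.
move=> xE; rewrite /total_weight (bigD1 x)//= lerDl sumr_ge0// => y _.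
by rewrite ltW ?repulsive_weight_gt0.
Qed.

(** Stability of E under [zero_off I] says, for the purpose of counting ones,
    that E only depends on the coordinates in I: the coordinates in I alone of
    a point of E carry at least as many ones as a sparsest point x of E.  Hence
    a point of both events has at least a + b ones, and the weights compare as
    N ^ 2 * e ^ ((a + b) ^ 2) < e ^ (a ^ 2) * e ^ (b ^ 2), with N the number of
    points of the cube. *)
Lemma total_weight_setI_lt I J E F :
  [disjoint I & J]%B ->
  (forall x, x \in E -> zero_off I x \in E) ->
  (forall x, x \in F -> zero_off J x \in F) ->
  [ffun=> false] \notin E -> [ffun=> false] \notin F ->
  E != finset.set0 -> F != finset.set0 ->
  total_weight (E :&: F) * total_weight [set: cube n]%SET <
  total_weight E * total_weight F.
Proof.
move=> disIJ E_off F_off E0 F0 /set0Pn[x0 x0E] /set0Pn[y0 y0F].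
have min_ones (G : {set cube n}) x1 : x1 \in G -> [ffun=> false] \notin G ->
    exists2 x, x \in G & (0 < #|ones x|)%N /\
      forall y, y \in G -> (#|ones x| <= #|ones y|)%N.
  move=> x1G G0; case: (arg_minnP (fun x => #|ones x|) x1G) => x xG xmin.
  exists x => //; split; last exact: xmin.
  rewrite card_gt0; apply: contra G0 => /eqP x_none.
  rewrite (_ : [ffun=> false] = x)//; apply/ffunP => i; rewrite ffunE.
  by have := finset.in_set0 i; rewrite -x_none inE.
have [x xE [a_gt0 x_min]] := min_ones E x0 x0E E0.
have [y yF [b_gt0 y_min]] := min_ones F y0 y0F F0.
set a := #|ones x| in a_gt0 x_min; set b := #|ones y| in b_gt0 y_min.
have ab_le z : z \in E :&: F -> (a + b <= #|ones z|)%N.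
  rewrite inE => /andP[/E_off/x_min aI /F_off/y_min bJ].
  rewrite !ones_zero_off in aI bJ; apply: leq_trans (leq_add aI bJ) _.
  rewrite -cardsUI [X in (_ + X)%N](_ : _ = 0)%N ?addn0.
    by apply: subset_leq_card; rewrite -finset.setIUl finset.subsetIr.
  apply/eqP; rewrite cards_eq0 finset.setIACA finset.setIid.
  by move: disIJ; rewrite -setI_eq0 => /eqP ->; rewrite finset.set0I.
set N : R := #|{: cube n}|%:R.
have N_ge0 : 0 <= N by rewrite ler0n.
have e_gt0 := repulsion_gt0.
have Z_le : total_weight [set: cube n]%SET <= N.
  have := total_weight_le [set: cube n]%SET 0 (fun _ _ => leq0n _).
  by rewrite mulr1.
have W_ge0 G : 0 <= total_weight G.
  by rewrite sumr_ge0// => z _; rewrite ltW ?repulsive_weight_gt0.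
apply: (@lt_le_trans _ _ (repulsive_weight x * repulsive_weight y)); last first.
  by apply: ler_pM; rewrite ?total_weight_ge// ltW ?repulsive_weight_gt0.
apply: (@le_lt_trans _ _ (N * repulsion ^+ ((a + b) ^ 2) * N)).
  by apply: ler_pM => //; apply: total_weight_le.
(* Only the factor N ^ 2 * repulsion ^ (2 * a * b) remains to be compared
   with 1; as a and b are positive, it is at most (N * repulsion) ^ 2. *)
rewrite /repulsive_weight -exprD -/a -/b sqrnD exprD mulrAC mulrA mulrAC.
rewrite gtr_pMl ?exprn_gt0//.
apply: (@le_lt_trans _ _ ((N * repulsion) ^+ 2)).
  rewrite exprMn -expr2 ler_wpM2l ?exprn_ge0//.
  rewrite ler_wiXn2l ?repulsion_le1 ?ltW//.
  by rewrite -[X in (X <= _)%N]muln1 leq_mul2l/= muln_gt0 a_gt0.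
rewrite exprn_ilt1//; first by rewrite mulr_ge0// ltW.
by rewrite /repulsion ltr_pdivrMr ?ltr0n// mul1r ltr_nat.
Qed.

Definition partition_function : R := total_weight [set: cube n]%SET.

Lemma partition_function_gt0 : 0 < partition_function.
Proof.
apply: lt_le_trans (repulsive_weight_gt0 [ffun=> false]) _.
by rewrite total_weight_ge ?inE.
Qed.

Lemma repulsive_measure_subproof :
  cube_prob R n (fun x => repulsive_weight x / partition_function).
Proof.
split=> [x|].
  by rewrite divr_ge0 ?ltW ?repulsive_weight_gt0 ?partition_function_gt0.
rewrite -mulr_suml -[RHS](divff (lt0r_neq0 partition_function_gt0)).
by congr (_ / _); apply: eq_bigl => x; rewrite inE.
Qed.

Definition repulsive_measure : cube_prob R n :=
  SigSub (mem_set repulsive_measure_subproof).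

Lemma mean_repulsive E :
  mean repulsive_measure (indic_of E) = total_weight E / partition_function.
Proof.
rewrite /mean /total_weight mulr_suml [RHS]big_mkcond; apply: eq_bigr => x _.
rewrite /indic_of /mass set_valE /=.
by case: (x \in E); rewrite ?mul1r ?mul0r.
Qed.

Lemma restr_zero_off I x : restr I (zero_off I x) = restr I x.
Proof. by apply/ffunP => i; rewrite !ffunE (valP i). Qed.

Lemma restr_surj I (y : subcube I) : exists x, restr I x = y.
Proof.
exists [ffun i => oapp y false (insub i)].
by apply/ffunP => i; rewrite !ffunE valK.
Qed.

Lemma repulsive_cyl_cov (EF : cylinder n * cylinder n) :
  increasing_pair R n EF -> cyl_cov R n EF repulsive_measure < 0.
Proof.
case: EF => -[I A] [J B] [/= dis [A_nc A_nd] [B_nc B_nd]].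
have [A0 [yA yAA]] := nontrivial_upset _ _ _ _ A_nd A_nc.
have [B0 [yB yBB]] := nontrivial_upset _ _ _ _ B_nd B_nc.
have pre0 (K : {set 'I_n}) (C : {set subcube K}) :
    [ffun=> false] \notin C -> [ffun=> false] \notin restr K @^-1: C.
  rewrite inE; congr (_ \notin C).
  by apply/ffunP => i; rewrite !ffunE.
have pre_neq0 (K : {set 'I_n}) (C : {set subcube K}) y :
    y \in C -> restr K @^-1: C != finset.set0.
  have [x <-] := restr_surj K y => xC.
  by apply/set0Pn; exists x; rewrite inE.
have pre_off (K : {set 'I_n}) (C : {set subcube K}) x :
  x \in restr K @^-1: C -> zero_off K x \in restr K @^-1: C.
  by rewrite !inE restr_zero_off.
have preE (K : {set 'I_n}) (C : {set subcube K}) :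
    (indic_of C \o restr K : _ -> R) = indic_of (restr K @^-1: C).
  by apply/funext => x; rewrite /indic_of /= inE.
rewrite /cyl_cov /cyl_indic /= !preE /cube_cov !mean_repulsive.
rewrite (_ : (fun x => _) =
    indic_of (restr I @^-1: A :&: restr J @^-1: B)); last first.
  by apply/funext => x; rewrite /indic_of !inE -natrM mulnb.
have Z_gt0 := partition_function_gt0.
rewrite mean_repulsive subr_lt0 mulrACA -invfM.
rewrite ltr_pdivlMr ?mulr_gt0// mulrA divfK ?lt0r_neq0//.
apply: (total_weight_setI_lt I J) => //; [exact: pre_off|exact: pre_off| | | |].
- exact: pre0.
- exact: pre0.
- exact: pre_neq0 yAA.
- exact: pre_neq0 yBB.
Qed.

End RepulsiveMeasure.

Theorem theorem1 (R : realType) (n : nat) :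
  [/\ boundary (NC R n) `<=`
        [set mu | NC R n mu /\
          exists i j : 'I_n, i != j /\
            marginal2 mu i j true true =
              marginal1 mu i true * marginal1 mu j true],
      boundary (NA R n) `<=`
        [set mu | NA R n mu /\
          exists (I J : {set 'I_n}) (f : subcube I -> R) (g : subcube J -> R),
            [/\ [disjoint I & J]%B,
                nonconst f /\ nondecr f,
                nonconst g /\ nondecr g &
                cube_cov mu (f \o @restr n I) (g \o @restr n J) = 0]],
      (NC R n)° !=set0 &
      (NA R n)° !=set0].
Proof.
have intNA : (NA R n)° (repulsive_measure R n).
  rewrite NA_constraints; apply: interior_strict => [EF|EF].
    exact: cube_cov_continuous.
  exact: repulsive_cyl_cov.
split.
- rewrite {1}NC_constraints => mu /boundary_constraints[|muNC].
    by move=> k; exact: cube_cov_continuous.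
  move=> [[i j] /= [ij cov0]]; split; first by rewrite NC_constraints.
  exists i, j; split=> //; apply/eqP.
  by rewrite -subr_eq0 -cube_cov_coordinate cov0.
- rewrite {1}NA_constraints => mu /boundary_constraints[|muNA].
    by move=> EF; exact: cube_cov_continuous.
  move=> [[E F] [[dis E_ok F_ok] cov0]]; split; first by rewrite NA_constraints.
  by exists (tag E), (tag F), (cyl_indic R n E), (cyl_indic R n F).
- by exists (repulsive_measure R n); apply: interiorS intNA; exact: NA_sub_NC.
- by exists (repulsive_measure R n).
Qed.
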